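(* For $\omega_0\in 2\pi\mathbb{Q}$ and $0\le r\le 1/3$, let $\mathcal{I}_r=\mathcal{I}_r(\omega_0)$ be the resonance interval of $\omega_0$ for the family $R_{r,\Omega}$. Then the width of $\mathcal{I}_r$ is bounded by $Cr^2$ when $\omega_0=\pi$, and by $Cr$ for general $\omega_0=2\pi p/q$: that is, there is a constant $C$ with $|\mathcal{I}_r(\pi)|\le Cr^2$ for all $0\le r\le1/3$, and for each $\omega_0\in2\pi\mathbb{Q}$ there is a constant $C$ with $|\mathcal{I}_r(\omega_0)|\le Cr$ for all $0\le r\le 1/3$.
   Context: For $r\in[0,1)$ and $\Omega\in\mathbb{R}$, the circle map $R_{r,\Omega}$ of $\mathbb{R}/2\pi\mathbb{Z}$ is given by the lift $$R_{r,\Omega}(\phi)=\phi+\Omega-2\sum_{k=1}^\infty\frac{r^k}{k}\sin(k\phi).$$ Its rotation number (for $r\le1/3$, where the map is an orientation-preserving circle homeomorphism) is $\omega(R_{r,\Omega})=\lim_{n\to\infty}\dfrac{R_{r,\Omega}^n(\phi_0)-\phi_0}{n}$, computed with this lift; it is independent of $\phi_0$. The resonance interval $\mathcal{I}_r(\omega_0)$ of $\omega_0\in2\pi\mathbb{Q}$ is the set of $\Omega\in\mathbb{R}$ with $\omega(R_{r,\Omega})=\omega_0$, which is an interval; its width $|\mathcal{I}_r(\omega_0)|$ is its length. *)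

(* Defs.v *)
From Stdlib Require Import Reals QArith Qreals.
From Coquelicot Require Import Coquelicot.
Open Scope R_scope.

(* The series over k >= 1 is reindexed by k = S j, since Series starts at 0. *)
Definition circle_map (r Omega phi : R) : R :=
  phi + Omega
  - 2 * Series (fun j : nat => r ^ S j / INR (S j) * sin (INR (S j) * phi)).

(* Rotation number of the circle map with lift F, in radians per iterate.  It is
   a property of F alone, so the limit is required from every starting point. *)
Definition is_rotation_number (F : R -> R) (omega : R) : Prop :=
  forall phi0 : R,
    is_lim_seq (fun n : nat => (Nat.iter n F phi0 - phi0) / INR n) omega.

Definition resonance_interval (r omega0 : R) : R -> Prop :=
  fun Omega => is_rotation_number (circle_map r Omega) omega0.

(* Length sup I - inf I of an interval I, in the extended reals: it is p_infty
   when I is unbounded. *)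
Definition width (I : R -> Prop) : Rbar :=
  Rbar_minus (Lub_Rbar I) (Glb_Rbar I).

Definition in_2piQ (omega : R) : Prop :=
  exists x : Q, omega = 2 * PI * Q2R x.

(* Main.v *)
(** If the displacement of a lift stays within [M] of a constant [Omega], its
    rotation number does too.  One iterate of the circle map has
    [M = O(r)]; this gives the linear bound.  When [omega = PI], it also gives
    [Omega = PI + O(r)], so the first harmonics [-2 r sin] at [phi] and at
    [R phi = phi + PI + O(r)] cancel up to [O(r^2)], and the second iterate has
    displacement [2 Omega + O(r^2)]. *)
Require Import Defs.
From Stdlib Require Import Reals QArith Qreals.
From Coquelicot Require Import Coquelicot.
From Stdlib Require Import Lra Lia.
Open Scope R_scope.

Lemma sin_lipschitz (x y : R) : Rabs (sin x - sin y) <= Rabs (x - y).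
Proof.
  destruct (MVT_gen sin y x cos) as [c [_ Hc]].
  - intros z _. apply is_derive_sin.
  - intros z _. apply continuity_sin.
  - rewrite Hc, Rabs_mult.
    assert (Rabs (cos c) <= 1) by (apply Rabs_le, COS_bound).
    pose proof (Rabs_pos (x - y)). nra.
Qed.

(** Comparison with a geometric series. Taking [c = r] bounds all harmonics together, and
    [c = r ^ 2] those past the first; summability is what allows the first term to be split off. *)
Lemma Series_geom_bound (a : nat -> R) (c r : R) :
  0 <= r < 1 -> (forall j, Rabs (a j) <= c * r ^ j) ->
  ex_series a /\ Rabs (Series a) <= c / (1 - r).
Proof.
  intros Hr Ha.
  assert (Hg : is_series (fun j => c * r ^ j) (c / (1 - r))).
  { apply (is_series_scal_l c (fun j => r ^ j) (/ (1 - r))).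
    apply is_series_geom.
    rewrite Rabs_pos_eq; lra. }
  assert (Habs : ex_series (fun j => Rabs (a j))).
  { apply (ex_series_le (fun j => Rabs (a j)) (fun j => c * r ^ j)).
    - intros j. unfold norm; simpl. unfold abs; simpl.
      rewrite Rabs_Rabsolu. apply Ha.
    - eexists; exact Hg. }
  split; [now apply ex_series_Rabs|].
  apply Rle_trans with (1 := Series_Rabs a Habs).
  rewrite <- (is_series_unique _ _ Hg).
  apply Series_le; [|eexists; exact Hg].
  intros j; split; [apply Rabs_pos | apply Ha].
Qed.

Lemma Rabs_harmonic_le (r phi : R) (k : nat) :
  0 <= r -> Rabs (r ^ S k / INR (S k) * sin (INR (S k) * phi)) <= r ^ S k.
Proof.
  intros Hr.
  assert (Hp : 0 <= r ^ S k) by now apply pow_le.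
  assert (Hk : 1 <= INR (S k)) by (apply (le_INR 1); lia).
  assert (Hi : 0 < / INR (S k) <= 1).
  { split; [apply Rinv_0_lt_compat; lra|].
    rewrite <- Rinv_1. apply Rinv_le_contravar; lra. }
  assert (Hs : Rabs (sin (INR (S k) * phi)) <= 1) by apply Rabs_le, SIN_bound.
  rewrite Rabs_mult. unfold Rdiv. rewrite Rabs_mult, !Rabs_pos_eq by lra.
  pose proof (Rabs_pos (sin (INR (S k) * phi))).
  assert (0 <= r ^ S k * / INR (S k) <= r ^ S k) by nra.
  nra.
Qed.

Lemma circle_map_displacement (r Omega phi : R) :
  0 <= r <= 1 / 3 -> Rabs (circle_map r Omega phi - phi - Omega) <= 3 * r.
Proof.
  intros Hr. unfold circle_map.
  set (a := fun j : nat => _).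
  destruct (Series_geom_bound a r r) as [_ H]; [lra| |].
  - intros j. now apply Rabs_harmonic_le.
  (* Here [r <= 1 / 3] enters, through [1 - r >= 2 / 3]. The factor 2 in front of the series turns
     [3 / 2] into 3. *)
  - assert (r / (1 - r) <= 3 / 2 * r).
    { apply Rle_div_l; nra. }
    apply Rabs_le_between in H. apply Rabs_le_between. lra.
Qed.

Lemma circle_map_first_harmonic (r Omega phi : R) :
  0 <= r <= 1 / 3 ->
  Rabs (circle_map r Omega phi - phi - Omega + 2 * r * sin phi) <= 3 * r ^ 2.
Proof.
  intros Hr. unfold circle_map.
  set (a := fun j : nat => _).
  assert (Ha : forall j, Rabs (a j) <= r ^ S j)
    by (intros j; now apply Rabs_harmonic_le).
  destruct (Series_geom_bound a r r) as [Hex _]; [lra|exact Ha|].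
  (* The tail starts at the second harmonic, so its terms are at most [r ^ 2 * r ^ j]. *)
  destruct (Series_geom_bound (fun j => a (S j)) (r ^ 2) r) as [_ H]; [lra| |].
  - intros j. rewrite <- pow_add. apply Ha.
  - rewrite (Series_incr_1 a Hex).
    assert (Ha0 : a 0%nat = r * sin phi).
    { unfold a. simpl. rewrite !Rmult_1_r, !Rmult_1_l. field. }
    rewrite Ha0.
    assert (r ^ 2 / (1 - r) <= 3 / 2 * r ^ 2).
    { apply Rle_div_l; nra. }
    apply Rabs_le_between in H. apply Rabs_le_between. lra.
Qed.

Lemma iter_displacement (F : R -> R) (Omega M phi : R) (n : nat) :
  (forall x, Rabs (F x - x - Omega) <= M) ->
  Rabs (Nat.iter n F phi - phi - INR n * Omega) <= INR n * M.
Proof.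
  intros HF. induction n as [|n IH].
  - simpl. rewrite !Rmult_0_l, Rminus_diag, Rminus_0_r, Rabs_R0. lra.
  - rewrite S_INR. simpl Nat.iter.
    specialize (HF (Nat.iter n F phi)).
    apply Rabs_le_between in HF, IH. apply Rabs_le_between. lra.
Qed.

(** The mean of [n] displacements, each within [M] of [Omega], is itself within [M] of [Omega], and
    closed bounds survive the limit. *)
Lemma rotation_number_near_translation (F : R -> R) (Omega M omega : R) :
  (forall x, Rabs (F x - x - Omega) <= M) ->
  is_rotation_number F omega -> Rabs (omega - Omega) <= M.
Proof.
  intros HF Hrot.
  assert (Hn : forall n, (1 <= n)%nat ->
    Omega - M <= (Nat.iter n F 0 - 0) / INR n <= Omega + M).
  { intros n Hn.
    assert (Hp : 0 < INR n) by (apply lt_0_INR; lia).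
    pose proof (iter_displacement F Omega M 0 n HF) as H.
    apply Rabs_le_between in H.
    split; [apply Rle_div_r | apply Rle_div_l]; lra. }
  assert (Omega - M <= omega).
  { apply (is_lim_seq_le_loc (fun _ => Omega - M)
      (fun n => (Nat.iter n F 0 - 0) / INR n) (Omega - M) omega).
    - exists 1%nat. intros n H. now apply Hn.
    - apply is_lim_seq_const.
    - apply Hrot. }
  assert (omega <= Omega + M).
  { apply (is_lim_seq_le_loc (fun n => (Nat.iter n F 0 - 0) / INR n)
      (fun _ => Omega + M) omega (Omega + M)).
    - exists 1%nat. intros n H'. now apply Hn.
    - apply Hrot.
    - apply is_lim_seq_const. }
  apply Rabs_le_between. lra.
Qed.

(** The quotients of the second iterate are twice the even-indexed quotients of [F], a subsequence
    with the same limit. *)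
Lemma is_rotation_number_square (F : R -> R) (omega : R) :
  is_rotation_number F omega ->
  is_rotation_number (fun x => F (F x)) (2 * omega).
Proof.
  intros H phi.
  assert (Hit : forall n, Nat.iter n (fun x => F (F x)) phi
                          = Nat.iter (2 * n) F phi).
  { induction n as [|n IH]; [reflexivity|].
    replace (2 * S n)%nat with (S (S (2 * n))) by lia.
    change (F (F (Nat.iter n (fun x => F (F x)) phi))
            = F (F (Nat.iter (2 * n) F phi))).
    now rewrite IH. }
  apply is_lim_seq_ext_loc with
    (fun n => 2 * ((Nat.iter (2 * n) F phi - phi) / INR (2 * n))).
  - exists 1%nat. intros n Hn. rewrite Hit, mult_INR.
    assert (0 < INR n) by (apply lt_0_INR; lia).
    change (INR 2) with 2. field. lra.
  - apply (is_lim_seq_scal_l _ 2 omega).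
    apply (is_lim_seq_subseq (fun n => (Nat.iter n F phi - phi) / INR n)
             omega (fun n => (2 * n)%nat)).
    + apply eventually_subseq. intros n. lia.
    + apply H.
Qed.

Lemma circle_map_square_displacement (r Omega phi : R) :
  0 <= r <= 1 / 3 -> Rabs (Omega - PI) <= 3 * r ->
  Rabs (circle_map r Omega (circle_map r Omega phi) - phi - 2 * Omega)
    <= 18 * r ^ 2.
Proof.
  intros Hr HO.
  pose proof (circle_map_displacement r Omega phi Hr) as H0.
  pose proof (circle_map_first_harmonic r Omega phi Hr) as H1.
  set (psi := circle_map r Omega phi) in *.
  pose proof (circle_map_first_harmonic r Omega psi Hr) as H2.
  (* Since [sin psi = - sin (psi - PI)], the sum is a difference of sines at points at most
     [3 * r + 3 * r] apart: one [3 * r] from the displacement, one from [Omega - PI]. *)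
  assert (Hs : Rabs (sin psi + sin phi) <= 6 * r).
  { replace (sin psi + sin phi) with (sin phi - sin (psi - PI)).
    2:{ rewrite sin_minus, sin_PI, cos_PI. ring. }
    apply Rle_trans with (1 := sin_lipschitz _ _).
    apply Rabs_le_between in H0, HO. apply Rabs_le_between. lra. }
  (* The two remainders give [2 * (3 * r ^ 2)], and the first harmonics give [2 * r * (6 * r)]: in
     all [18 * r ^ 2]. *)
  apply Rabs_le_between in H1, H2, Hs. apply Rabs_le_between. nra.
Qed.

(* An empty [I] has width [m_infty], so it needs no separate hypothesis. *)
Lemma width_le_of_near (I : R -> Prop) (c M : R) :
  (forall x, I x -> Rabs (c - x) <= M) -> Rbar_le (width I) (2 * M).
Proof.
  intros HI. unfold width.
  assert (Hl : Rbar_le (Lub_Rbar I) (c + M)).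
  { apply (proj2 (Lub_Rbar_correct I)). intros x Hx.
    specialize (HI x Hx). apply Rabs_le_between in HI. simpl. lra. }
  assert (Hg : Rbar_le (c - M) (Glb_Rbar I)).
  { apply (proj2 (Glb_Rbar_correct I)). intros x Hx.
    specialize (HI x Hx). apply Rabs_le_between in HI. simpl. lra. }
  (* [Hl] and [Hg] rule out a supremum [p_infty] and an infimum [m_infty]; every other infinite case
     has difference [m_infty]. *)
  destruct (Lub_Rbar I), (Glb_Rbar I); simpl in *; try tauto; lra.
Qed.

Lemma resonance_near (r omega Omega : R) :
  0 <= r <= 1 / 3 -> resonance_interval r omega Omega ->
  Rabs (omega - Omega) <= 3 * r.
Proof.
  intros Hr. apply rotation_number_near_translation.
  intros x. now apply circle_map_displacement.
Qed.

(** A bootstrap: the linear bound supplies the closeness of [Omega] to [PI] that the second-iterate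
    estimate requires. Halving that estimate turns 18 into 9. *)
Lemma resonance_PI_near (r Omega : R) :
  0 <= r <= 1 / 3 -> resonance_interval r PI Omega ->
  Rabs (PI - Omega) <= 9 * r ^ 2.
Proof.
  intros Hr HI.
  pose proof (resonance_near r PI Omega Hr HI) as HO.
  rewrite Rabs_minus_sym in HO.
  assert (H : Rabs (2 * PI - 2 * Omega) <= 18 * r ^ 2).
  { apply (rotation_number_near_translation
             (fun x => circle_map r Omega (circle_map r Omega x))).
    - intros x. now apply circle_map_square_displacement.
    - now apply is_rotation_number_square. }
  apply Rabs_le_between in H. apply Rabs_le_between. lra.
Qed.

Theorem theorem5p3 :
  (exists C : R, forall r : R, 0 <= r <= 1 / 3 ->
     Rbar_le (width (resonance_interval r PI)) (C * r ^ 2)) /\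
  (forall omega0 : R, in_2piQ omega0 ->
     exists C : R, forall r : R, 0 <= r <= 1 / 3 ->
       Rbar_le (width (resonance_interval r omega0)) (C * r)).
Proof.
  split.
  (* Both constants, 18 here and 6 below, are twice the radius of the neighbourhood of [omega0] that
     contains the interval. *)
  - exists 18. intros r Hr.
    replace (18 * r ^ 2) with (2 * (9 * r ^ 2)) by ring.
    apply width_le_of_near with PI. intros x. now apply resonance_PI_near.
  - intros omega0 _. exists 6. intros r Hr.
    replace (6 * r) with (2 * (3 * r)) by ring.
    apply width_le_of_near with omega0. intros x. now apply resonance_near.
Qed.
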